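(* Let $n,m\ge 1$ be integers and $q>0$ with $q\neq 1$. Let $\alpha_m$ be the law of $m$ consecutive states $\bar x=(x^1,\ldots,x^m)$ of the stationary Markov chain on $C_n$ with initial law $\mu$ and transition kernel $m_q$, i.e. $$\alpha_m(d\bar x)=\mu(dx^1)\,m_q(x^1,dx^2)\cdots m_q(x^{m-1},dx^m).$$ Write $x^r=\{e^{ia^r_1},\ldots,e^{ia^r_n}\}$ with $a^r\in D_n$ for $r=1,\ldots,m$, and set $a^0_j=a^{m+1}_j=j-1$ for $j=1,\ldots,n$. Then $$\alpha_m(d\bar x)=Z_m^{-1}\prod_{r=0}^m\det\left(\phi_{r,r+1}(a^r_j,a^{r+1}_k)\right)_{1\le j,k\le n}\,d\bar x,$$ where $Z_m=\tilde c_q^{\,m-1}\left(1-(-1)^{n-1}q^{2\pi}\right)^{-(m-1)}(2\pi)^n$.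
   Context: Here $i=\sqrt{-1}$ (not used as an index). $C_n$ is the set of conjugacy classes of $U(n)$, identified with unlabelled configurations of $n$ points (with multiplicity) on the unit circle, equivalently with $D_n=\{\theta\in\mathbb{R}^n:0\le\theta_1\le\cdots\le\theta_n<2\pi\}$ via $\theta\mapsto\{e^{i\theta_1},\ldots,e^{i\theta_n}\}$. $dx$ denotes the measure on $C_n$ corresponding to Lebesgue measure on $D_n$, and $d\bar x=dx^1\cdots dx^m$. For $x=\{e^{i\theta_1},\ldots,e^{i\theta_n}\}$, $\Delta(x)=\prod_{1\le l<p\le n}|e^{i\theta_l}-e^{i\theta_p}|$, and $\mu(dx)=(2\pi)^{-n}\Delta(x)^2dx$ (the probability measure induced by Haar measure on $U(n)$). For $a,b\in D_n$ write $a\prec b$ if $a_1\le b_1<a_2\le b_2<\cdots<a_n\le b_n$, and $a\succ b$ if $b_1<a_1\le b_2<a_2\le\cdots\le b_n<a_n$. For $y=\{e^{ia_1},\ldots,e^{ia_n}\}$, $z=\{e^{ib_1},\ldots,e^{ib_n}\}$ with $a,b\in D_n$, write $y\prec z$ if $a\prec b$ or $a\succ b$, and let $l(y,z)=\sum_j(b_j-a_j)$ if this sum is $\ge0$, and $l(y,z)=\sum_j(b_j-a_j)+2\pi$ otherwise. Let $\mathcal{I}_q(y,z)=q^{l(y,z)}$ if $y\prec z$ and $\mathcal{I}_q(y,z)=0$ otherwise. Let $c_q=\int_0^{2\pi}|1-e^{ir}|^{n-1}q^r\,dr$ and $\tilde c_q=c_q/(n-1)!$. The Markov kernel $m_q$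 on $C_n$ is $m_q(y,dz)=c_q^{-1}\int_0^{2\pi}|1-e^{ir}|^{n-1}q^r\,p_r(y,dz)\,dr$, where $p_r(y,\cdot)$ is the law of the conjugacy class of $DMD_yM^*$ with $D=\mathrm{diag}(e^{ir},1,\ldots,1)$, $D_y$ a diagonal matrix in the class $y$, and $M$ Haar distributed on $U(n)$. For $\Delta(y)\ne0$ it is given explicitly by $$m_q(y,dz)=\tilde c_q^{-1}\frac{\Delta(z)}{\Delta(y)}\,\mathcal{I}_q(y,z)\,dz.$$ Let $f:\mathbb{R}\to\mathbb{C}$, $f(u)=\dfrac{(qe^{i(n-1)/2})^{u\bmod 2\pi}}{1-(-1)^{n-1}q^{2\pi}}$, where $u\bmod 2\pi\in[0,2\pi)$ and $(qe^{i(n-1)/2})^{t}=q^te^{it(n-1)/2}$. Define $\phi_{r,r+1}(a,b)=f(b-a)$ for $1\le r\le m-1$ and $a,b\in[0,2\pi)$; $\phi_{0,1}(a,b)=e^{iab}$ for $a\in\mathbb{R}$, $b\in[0,2\pi)$; $\phi_{m,m+1}(a,b)=e^{-iab}$ for $a\in[0,2\pi)$, $b\in\mathbb{R}$. *)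

(* Defs.v *)
From HB Require Import structures.
From mathcomp Require Import all_boot all_order all_algebra.
From mathcomp Require Import all_classical all_reals all_analysis.
From mathcomp Require Import measurable_realfun complex.
Set Implicit Arguments.
Unset Strict Implicit.
Unset Printing Implicit Defensive.
Import Order.TTheory GRing.Theory Num.Theory.
Import numFieldNormedType.Exports.
Local Open Scope classical_set_scope.
Local Open Scope ring_scope.
Local Open Scope complex_scope.

Definition tcons (T : Type) (n : nat) (p : T * n.-tuple T) : n.+1.-tuple T :=
  [tuple of p.1 :: p.2].

Section power_measure.
Local Open Scope ereal_scope.
Context d (T : measurableType d) (R : realType).

Lemma measurable_tcons n :
  measurable_fun [set: (T * n.-tuple T)%type] (@tcons T n).
Proof. exact: measurable_cons. Qed.

Section cons_measure.
Variables (mu : {sigma_finite_measure set T -> \bar R}) (n : nat).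
Variable nu : {sigma_finite_measure set (n.-tuple T) -> \bar R}.

Definition cons_measure : set (n.+1.-tuple T) -> \bar R :=
  pushforward (mu \x nu) (@tcons T n).

Let mpre A : measurable A -> measurable (@tcons T n @^-1` A).
Proof. by move=> mA; rewrite -[X in measurable X]setTI; exact: measurable_tcons. Qed.

Let cons_measure0 : cons_measure set0 = 0.
Proof. by rewrite /cons_measure/pushforward preimage_set0 measure0. Qed.

Let cons_measure_ge0 A : 0 <= cons_measure A.
Proof. by apply: integral_ge0 => x _; exact: measure_ge0. Qed.

Let cons_measure_sigma_additive : semi_sigma_additive cons_measure.
Proof.
move=> F mF tF mUF; rewrite /cons_measure /pushforward preimage_bigcup.
apply: measure_semi_sigma_additive.
- by move=> k; exact: mpre.
- apply/trivIsetP => /= i j _ _ ij; rewrite -preimage_setI.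
  by move/trivIsetP : tF => /(_ _ _ _ _ ij) ->//; rewrite preimage_set0.
- by rewrite -preimage_bigcup; exact: mpre.
Qed.

HB.instance Definition _ := isMeasure.Build _ _ _ cons_measure
  cons_measure0 cons_measure_ge0 cons_measure_sigma_additive.

Let cons_measure_sigma_finite : sigma_finite setT cons_measure.
Proof.
have /sigma_finiteP[F [TF ndF Foo]] := sigma_finiteT mu.
have /sigma_finiteP[G [TG ndG Goo]] := sigma_finiteT nu.
pose u (t : n.+1.-tuple T) : T * n.-tuple T :=
  (tnth t ord0, [tuple of behead t]).
have mu_ : measurable_fun [set: n.+1.-tuple T] u.
  by apply: measurable_fun_pair; [exact: measurable_tnth|exact: measurable_behead].
exists (fun k => u @^-1` (F k `*` G k)).
  apply/esym/seteqP; split=> // t _.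
  have [i _ Fi] : (\bigcup_i F i) (u t).1 by rewrite -TF.
  have [j _ Gj] : (\bigcup_i G i) (u t).2 by rewrite -TG.
  exists (maxn i j) => //; split.
    by move: Fi; exact/subsetPset/ndF/leq_maxl.
  by move: Gj; exact/subsetPset/ndG/leq_maxr.
move=> k; have [mF Fk] := Foo k; have [mG Gk] := Goo k; split.
  by rewrite -[X in measurable X]setTI; apply: mu_ => //; exact: measurableX.
have uK p : u (tcons p) = p.
  by case: p => x t; congr pair; rewrite ?(tnth_nth x)//; exact/val_inj.
rewrite /cons_measure /pushforward (_ : _ @^-1` _ = F k `*` G k).
  by rewrite product_measure1E// lte_mul_pinfty// ge0_fin_numE.
by rewrite -comp_preimage (_ : u \o _ = id) ?preimage_id//; exact/funext.
Qed.

HB.instance Definition _ := Measure_isSigmaFinite.Build _ _ _ cons_measure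
  cons_measure_sigma_finite.

End cons_measure.

Fixpoint power_measure (mu : {sigma_finite_measure set T -> \bar R}) (n : nat) :
    {sigma_finite_measure set (n.-tuple T) -> \bar R} :=
  match n with
  | 0 => \d_ [tuple]
  | k.+1 => cons_measure mu (power_measure mu k)
  end.

End power_measure.

(* Law of the first m states of the Markov chain with initial law nu and
   transition kernel k :
   nu(dx_1) k(x_1, dx_2) ... k(x_(m-1), dx_m), as an iterated integral. *)
Fixpoint chain_law d (T : measurableType d) (R : realType)
    (k : T -> {measure set T -> \bar R}) (nu : {measure set T -> \bar R})
    (m : nat) : set (m.-tuple T) -> \bar R :=
  match m with
  | 0 => fun A => \d_ [tuple] A
  | p.+1 => fun A =>
      (\int[nu]_x chain_law k (k x) [set t : p.-tuple T | A (tcons (x, t))])%E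
  end.

Section circle.
Context (R : realType).

Definition cis (t : R) : R[i] := cos t +i* sin t.

Definition mod2pi (u : R) : R := u - 2 * pi * (Num.floor (u / (2 * pi)))%:~R.

End circle.

(* A conjugacy class of U(n) is represented by its ordered angles
   0 <= a_1 <= ... <= a_n < 2 pi; conf R n is this set of angles with the
   trace of the Borel sigma-algebra of R^n. *)
Section configurations.
Context (R : realType) (n : nat).

Definition in_weyl (a : n.-tuple R) : bool :=
  [forall j : 'I_n, 0 <= tnth a j < 2 * pi] &&
  [forall j : 'I_n, forall k : 'I_n, (j <= k)%N ==> (tnth a j <= tnth a k)].

Definition weyl : Type := {a : n.-tuple R | in_weyl a}.

Fact in_weyl0 : in_weyl [tuple of nseq n 0].
Proof.
apply/andP; split.
  by apply/forallP => j; rewrite tnth_nseq lexx mulr_gt0// pi_gt0.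
by apply/forallP => j; apply/forallP => k; rewrite !tnth_nseq lexx implybT.
Qed.

HB.instance Definition _ := Choice.on weyl.
HB.instance Definition _ :=
  isPointed.Build weyl (exist (fun a => in_weyl a) _ in_weyl0).

Definition weyl_val (a : weyl) : n.-tuple R := val a.

Definition conf := g_sigma_algebra_preimageType weyl_val.

Definition angles (x : conf) : n.-tuple R := weyl_val x.

Definition Delta (x : conf) : R :=
  \prod_(l < n) \prod_(p < n | (l < p)%N)
    Normc.normc (cis (tnth (angles x) l) - cis (tnth (angles x) p)).

(* a_1 <= b_1 < a_2 <= b_2 < ... < a_n <= b_n *)
Definition interlace_up (a b : n.-tuple R) : bool :=
  [forall j : 'I_n, tnth a j <= tnth b j] &&
  [forall j : 'I_n, forall k : 'I_n, (k == j.+1 :> nat) ==> (tnth b j < tnth a k)].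

(* b_1 < a_1 <= b_2 < a_2 <= ... <= b_n < a_n *)
Definition interlace_down (a b : n.-tuple R) : bool :=
  [forall j : 'I_n, tnth b j < tnth a j] &&
  [forall j : 'I_n, forall k : 'I_n, (k == j.+1 :> nat) ==> (tnth a j <= tnth b k)].

Definition interlace (y z : conf) : bool :=
  interlace_up (angles y) (angles z) || interlace_down (angles y) (angles z).

Definition winding (y z : conf) : R :=
  let s := \sum_(j < n) (tnth (angles z) j - tnth (angles y) j) in
  if 0 <= s then s else s + 2 * pi.

Definition I_q (q : R) (y z : conf) : R :=
  if interlace y z then q `^ winding y z else 0.

End configurations.

Section conf_measures.
Context (R : realType) (n : nat).
Local Notation leb := (power_measure (@lebesgue_measure R) n).

Lemma measurable_in_weyl : measurable [set a : n.-tuple R | in_weyl a].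
Proof.
have mt j : measurable_fun setT (fun a : n.-tuple R => tnth a j).
  exact: measurable_tnth.
have mB (f : n.-tuple R -> bool) :
    measurable_fun setT f -> measurable [set a | f a].
  by move=> mf; rewrite -[X in measurable X]setTI; exact: (mf measurableT [set true]).
have -> : [set a : n.-tuple R | in_weyl a] =
    \bigcap_(j in [set: 'I_n])
      ([set a | 0 <= tnth a j < 2 * pi] `&` \bigcap_(k in [set: 'I_n])
        [set a | (j <= k)%N ==> (tnth a j <= tnth a k)]).
  apply/seteqP; split=> a.
    move=> /andP[/forallP h1 /forallP h2] j _; split; first exact: h1.
    by move=> k _; exact: (forallP (h2 j)).
  move=> h; apply/andP; split; apply/forallP => j; first by have [] := h j I.
  by apply/forallP => k; have [_] := h j I; exact.
apply: fin_bigcap_measurable; first exact: finite_finset.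
move=> j _; apply: measurableI.
  apply: mB; apply: measurable_and; first exact: measurable_fun_ler.
  exact: measurable_fun_ltr.
apply: fin_bigcap_measurable; first exact: finite_finset.
move=> k _; case: (j <= k)%N => /=; last first.
  by rewrite (_ : [set _ | _] = setT)//; exact/seteqP.
by apply: mB; exact: measurable_fun_ler.
Qed.

Lemma measurable_angles : measurable_fun [set: conf R n] (@angles R n).
Proof. by move=> _ A mA; exists A. Qed.

Lemma image_angles (B : set (n.-tuple R)) :
  @angles R n @` (@angles R n @^-1` B) = B `&` [set a | in_weyl a].
Proof.
apply/seteqP; split=> [_ [x Bx <-]|a [Ba wa]]; first by split=> //; exact: valP.
by exists (exist (fun a => in_weyl a) a wa).
Qed.

Lemma measurable_image_angles (A : set (conf R n)) :
  measurable A -> measurable (@angles R n @` A).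
Proof.
move=> [B mB <-]; rewrite setTI image_angles.
by apply: measurableI => //; exact: measurable_in_weyl.
Qed.

Definition conf_leb (A : set (conf R n)) : \bar R := leb (@angles R n @` A).

Let conf_leb0 : conf_leb set0 = 0%E.
Proof. by rewrite /conf_leb image_set0 measure0. Qed.

Let conf_leb_ge0 A : (0 <= conf_leb A)%E.
Proof. exact: measure_ge0. Qed.

Let conf_leb_sigma_additive : semi_sigma_additive conf_leb.
Proof.
move=> F mF tF mUF; rewrite /conf_leb image_bigcup.
apply: measure_semi_sigma_additive.
- by move=> k; exact: measurable_image_angles.
- apply/trivIsetP => i j _ _ ij; apply/seteqP; split=> // a [[x Fx <-] [y Fy yx]].
  move/trivIsetP : tF => /(_ i j I I ij)/seteqP[+ _]; apply; split; first exact: Fx.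
  by rewrite (_ : x = y)//; apply: val_inj.
- by rewrite -image_bigcup; exact: measurable_image_angles.
Qed.

HB.instance Definition _ := isMeasure.Build _ _ _ conf_leb
  conf_leb0 conf_leb_ge0 conf_leb_sigma_additive.

Let conf_leb_sigma_finite : sigma_finite setT conf_leb.
Proof.
have [F FT Foo] := sigma_finiteT leb.
exists (fun k => @angles R n @^-1` F k).
  by rewrite -preimage_bigcup -FT preimage_setT.
move=> k; have [mF Fk] := Foo k; split; first by exists (F k) => //; rewrite setTI.
rewrite /conf_leb image_angles; apply: le_lt_trans Fk.
apply: le_measure; rewrite ?inE//.
by apply: measurableI => //; exact: measurable_in_weyl.
Qed.

HB.instance Definition _ := Measure_isSigmaFinite.Build _ _ _ conf_leb
  conf_leb_sigma_finite.

Lemma measurable_Delta : measurable_fun [set: conf R n] (@Delta R n).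
Proof.
have mt j : measurable_fun [set: conf R n] (fun x => tnth (angles x) j).
  exact: (measurableT_comp (measurable_tnth j) measurable_angles).
have mc (f : R -> R) : continuous f -> measurable_fun setT f.
  exact: continuous_measurable_fun.
apply: measurable_prod => l _.
under eq_fun do rewrite big_mkcond.
apply: measurable_prod => p _; case: (l < p)%N => //=.
have msqrt := mc _ (@sqrt_continuous R).
apply: (measurableT_comp msqrt).
apply: measurable_funD; apply: measurable_funX; apply: measurable_funB;
  by [exact: (measurableT_comp (mc _ (@continuous_cos R)) (mt _))
     |exact: (measurableT_comp (mc _ (@continuous_sin R)) (mt _))].
Qed.

Definition conf_haar (A : set (conf R n)) : \bar R :=
  (\int[conf_leb]_(x in A) ((2 * pi) ^- n * Delta x ^+ 2)%:E)%E.

Let dens_ge0 x : (0 <= ((2 * pi) ^- n * @Delta R n x ^+ 2)%:E)%E.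
Proof. 
rewrite lee_fin; apply: mulr_ge0; last exact: sqr_ge0.
by rewrite invr_ge0; apply: exprn_ge0; rewrite mulr_ge0// pi_ge0.
Qed.

Let conf_haar0 : conf_haar set0 = 0%E.
Proof. by rewrite /conf_haar integral_set0. Qed.

Let conf_haar_ge0 A : (0 <= conf_haar A)%E.
Proof. by apply: integral_ge0 => x _; exact: dens_ge0. Qed.

Let conf_haar_sigma_additive : semi_sigma_additive conf_haar.
Proof.
apply: semi_sigma_additive_nng_induced; last exact: dens_ge0.
apply/measurable_EFinP; apply: measurable_funM => //.
by apply: measurable_funX; exact: measurable_Delta.
Qed.

HB.instance Definition _ := isMeasure.Build _ _ _ conf_haar
  conf_haar0 conf_haar_ge0 conf_haar_sigma_additive.

End conf_measures.

Section unitary_group.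
Context (R : realType) (n : nat).

Definition unitary : Type := {M : 'M[R[i]]_n | M \is unitarymx}.

Fact unitarymx1 : (1%:M : 'M[R[i]]_n) \is unitarymx.
Proof. by apply/unitarymxP; rewrite trmx1 map_mx1 mulmx1. Qed.

HB.instance Definition _ := Choice.on unitary.
HB.instance Definition _ :=
  isPointed.Build unitary (exist (fun M => M \is unitarymx) _ unitarymx1).

Definition umx (U : unitary) : 'M[R[i]]_n := val U.

Definition umul (U V : unitary) : unitary :=
  exist (fun M => M \is unitarymx) _ (mul_unitarymx (valP U) (valP V)).

Definition entry_events : set (set unitary) :=
  \bigcup_(ij in [set: 'I_n * 'I_n])
    (preimage_set_system setT (fun U => complex.Re (umx U ij.1 ij.2)) measurable `|`
     preimage_set_system setT (fun U => complex.Im (umx U ij.1 ij.2)) measurable).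

Definition unitaryB := g_sigma_algebraType entry_events.

Definition is_haar (h : probability unitaryB R) : Prop :=
  forall (U : unitary) (A : set unitaryB), measurable A ->
    h (umul U @^-1` A) = h A.

Definition unitary_conj (X Y : 'M[R[i]]_n) : Prop :=
  exists V : unitary, X = umx V *m Y *m (umx V ^t*)%sesqui.

Definition diag_conf (y : conf R n) : 'M[R[i]]_n :=
  diag_mx (\row_j cis (tnth (angles y) j)).

Definition diag_rank1 (r : R) : 'M[R[i]]_n :=
  diag_mx (\row_j if val j == 0%N then cis r else 1).

Definition p_law (h : probability unitaryB R) (r : R) (y : conf R n)
    (A : set (conf R n)) : \bar R :=
  h [set M | exists2 z, A z & unitary_conj
       (diag_rank1 r *m umx M *m diag_conf y *m (umx M ^t*)%sesqui) (diag_conf z)].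

Definition c_q (q : R) : R :=
  \int[lebesgue_measure]_(r in `[0, 2 * pi])
    (Normc.normc (1 - cis r) ^+ n.-1 * q `^ r).

Definition tc_q (q : R) : R := c_q q / (n.-1)`!%:R.

(* m_q(y, A), from the laws p_r(y, .) *)
Definition m_q (h : probability unitaryB R) (q : R) (y : conf R n)
    (A : set (conf R n)) : \bar R :=
  ((c_q q)^-1%:E * \int[lebesgue_measure]_(r in `[0%R, (2 * pi)%R])
     ((Normc.normc (1 - cis r) ^+ n.-1 * q `^ r)%:E * p_law h r y A))%E.

Definition m_q_density (q : R) (y z : conf R n) : R :=
  (tc_q q)^-1 * (Delta z / Delta y) * I_q q y z.

End unitary_group.

Section determinants.
Context (R : realType) (n m : nat).

Definition f_q (q u : R) : R[i] :=
  (q `^ mod2pi u)%:C * cis (mod2pi u * (n.-1%:R / 2)) /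
  (1 - (-1) ^+ n.-1 * q `^ (2 * pi))%:C.

(* phi q r is phi_(r, r+1), for 0 <= r <= m. *)
Definition phi (q : R) (r : nat) (a b : R) : R[i] :=
  if r == 0%N then cis (a * b)
  else if r == m then cis (- (a * b))
  else f_q q (b - a).

Definition boundary : n.-tuple R := [tuple j%:R | j < n].

(* The vectors a^0, a^1, ..., a^m, a^(m+1). *)
Definition levels (x : m.-tuple (conf R n)) (r : nat) : n.-tuple R :=
  nth boundary (boundary :: rcons (map (@angles R n) x) boundary) r.

Definition Z_norm (q : R) : R :=
  tc_q n q ^+ m.-1 * (1 - (-1) ^+ n.-1 * q `^ (2 * pi)) ^- m.-1 *
  (2 * pi) ^+ n.

End determinants.

(* nu(dx) = g(x) mu(dx) for a complex-valued g; the integral of g is computed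
   on real and imaginary parts. *)
Definition has_complex_density d (T : measurableType d) (R : realType)
    (nu mu : set T -> \bar R) (g : T -> R[i]) : Prop :=
  [/\ mu.-integrable setT (fun x => (complex.Re (g x))%:E),
      mu.-integrable setT (fun x => (complex.Im (g x))%:E) &
      forall A, measurable A ->
        nu A = (\int[mu]_(x in A) (complex.Re (g x))%:E)%E /\
        (\int[mu]_(x in A) (complex.Im (g x))%:E)%E = 0%E].

(* Main.v *)
From HB Require Import structures.
Require Import Defs.
From mathcomp Require Import all_boot all_order all_algebra.
From mathcomp Require Import all_classical all_reals all_analysis.
From mathcomp Require Import measurable_realfun complex.
From mathcomp Require Import ring lra.
Set Implicit Arguments.
Unset Strict Implicit.
Unset Printing Implicit Defensive.
Import Order.TTheory GRing.Theory Num.Theory.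
Import numFieldNormedType.Exports.
Local Open Scope classical_set_scope.
Local Open Scope ring_scope.
Local Open Scope complex_scope.

(** The boundary determinants are Vandermonde determinants in e^(i a_j) and
    e^(-i a_j); writing each difference as a chord times a phase, their product
    is Delta(x^1) Delta(x^m) times a phase depending on the sums of angles.
    With Q = q e^(i(n-1)/2), the entries of a step determinant factor as
    Q^(b_k) Q^(-a_j) times 1 if a_j <= b_k and Q^(2 pi) otherwise, so up to these
    factors row j only depends on the number of b_k below a_j. The determinant
    therefore vanishes unless these numbers are 0, ..., n-1 (a before b) or
    1, ..., n (b before a), and it equals I_q(y, z) / (1 - Q^(2 pi)) times a phase.
    All phases telescope. So do the ratios Delta(z)/Delta(y) in the transition
    densities; the points where Delta vanishes do not matter, as both the initial
    density and the transition densities vanish there. *)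

(** * Determinants of two-valued staircase matrices *)

(** Right multiplication by the unitriangular [P] forms partial sums along rows. Row [j > 0] starts
    at [b] and jumps by [a - b] in column [j], while row 0 is constantly [a]; these increments form
    the lower triangular [T], with diagonal a, a - b, ..., a - b. *)
Lemma det_two_valued (F : comPzRingType) n (a b : F) :
  \det (\matrix_(j < n.+1, k < n.+1) (if (j <= k)%N then a else b)) =
  a * (a - b) ^+ n.
Proof.
pose T : 'M[F]_n.+1 := \matrix_(j, k)
  (if k == ord0 then if j == ord0 then a else b
   else if j == k then a - b else 0).
pose P : 'M[F]_n.+1 := \matrix_(j, k) (j <= k)%:R.
have -> : (\matrix_(j < n.+1, k < n.+1) (if (j <= k)%N then a else b)) = T *m P.
  apply/matrixP => j k; rewrite !mxE big_ord_recl !mxE eqxx leq0n mulr1.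
  case: (unliftP ord0 j) => [i ->|->].
    rewrite [lift _ _ == _]eq_sym (negbTE (neq_lift _ _)) (bigD1 i)//= !mxE.
    rewrite eqxx [lift _ _ == _]eq_sym (negbTE (neq_lift _ _)) big1 ?addr0.
      by case: ifP => _; rewrite ?mulr1 ?mulr0 ?addr0// addrC subrK.
    move=> l li; rewrite !mxE [lift _ _ == _]eq_sym (negbTE (neq_lift _ _)).
    by rewrite (inj_eq lift_inj) eq_sym (negbTE li) mul0r.
  rewrite eqxx big1 ?addr0// => l _; rewrite !mxE.
  by rewrite [lift _ _ == _]eq_sym !(negbTE (neq_lift _ _)) mul0r.
rewrite det_mulmx det_trig; last first.
  apply/is_trig_mxP => i j ij; rewrite mxE -val_eqE/= gtn_eqF; last first.
    exact: leq_ltn_trans (leq0n i) ij.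
  by rewrite -val_eqE/= ltn_eqF.
rewrite -[\det P]det_tr det_trig; last first.
  by apply/is_trig_mxP => i j ij; rewrite !mxE leqNgt ij.
rewrite [X in _ * X]big1 ?mulr1; last by move=> i _; rewrite !mxE leqnn.
rewrite big_ord_recl !mxE eqxx; congr (_ * _).
rewrite (eq_bigr (fun=> a - b)) ?prodr_const ?card_ord// => i _.
by rewrite !mxE eqxx eq_sym (negbTE (neq_lift _ _)).
Qed.

Lemma det_omit_last (F : comPzRingType) n (w : F) :
  \det (\matrix_(j < n.+1, k < n.+1) (if (k < j)%N then w else 1)) =
  (1 - w) ^+ n.
Proof.
rewrite -[RHS]mul1r -det_two_valued; congr (\det _).
by apply/matrixP => j k; rewrite !mxE ltnNge; case: (j <= k)%N.
Qed.

(** The transpose is an instance of [det_two_valued] with the values [w] and 1; the sign comes from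
    turning w - 1 into 1 - w. *)
Lemma det_omit_first (F : comPzRingType) n (w : F) :
  \det (\matrix_(j < n.+1, k < n.+1) (if (k < j.+1)%N then w else 1)) =
  (-1) ^+ n * w * (1 - w) ^+ n.
Proof.
rewrite -det_tr mulrAC -exprMn mulN1r opprB mulrC -det_two_valued.
by congr (\det _); apply/matrixP => j k; rewrite !mxE ltnS.
Qed.

(** Each step gains at least one. Taken from the first index and up to the last one, this pins down
    a strictly increasing [N] whose range has little room to spare. *)
Lemma homo_ltn_leqD n (N : 'I_n -> nat) :
  {homo N : i j / (i < j)%N >-> (i < j)%N} ->
  forall i j : 'I_n, (i <= j)%N -> (N i + (j - i) <= N j)%N.
Proof.
move=> mN i [j jn] /= ij; elim: j ij jn => [|j IH].
  rewrite leqn0 => /eqP i0 jn; rewrite sub0n addn0.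
  by apply: eq_leq; congr N; exact: val_inj.
rewrite leq_eqVlt => /orP[/eqP ij jn|ij jn].
  have -> : (j.+1 - i)%N = 0%N by rewrite ij subnn.
  by rewrite addn0; apply: eq_leq; congr N; exact: val_inj.
rewrite subSn// addnS; apply: leq_ltn_trans (IH ij (ltnW jn)) _.
exact: mN.
Qed.

(* N takes n + 1 values in {0, ..., n + 1}. Two equal values give two equal
   rows; if all are distinct, exactly one value is omitted, and when it is
   neither 0 nor n + 1 the last row is w times the first one. *)
Lemma det_staircase (F : comPzRingType) n (w : F) (N : 'I_n.+1 -> nat) :
  {homo N : i j / (i <= j)%N >-> (i <= j)%N} -> (forall j, N j <= n.+1)%N ->
  \det (\matrix_(j < n.+1, k < n.+1) (if (k < N j)%N then w else 1)) =
  if [forall j, N j == j] then (1 - w) ^+ n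
  else if [forall j, N j == j.+1] then (-1) ^+ n * w * (1 - w) ^+ n else 0.
Proof.
move=> mN leN; set A := (A in \det A).
case: ifPn => [/forallP N0|N0].
  rewrite -det_omit_last; congr (\det _); apply/matrixP => j k.
  by rewrite !mxE (eqP (N0 j)).
case: ifPn => [/forallP N1|N1].
  rewrite -det_omit_first; congr (\det _); apply/matrixP => j k.
  by rewrite !mxE (eqP (N1 j)).
have [smN|] := boolP [forall i : 'I_n.+1, forall j : 'I_n.+1,
    (i < j)%N ==> (N i < N j)%N]; last first.
  move=> /forallPn[i /forallPn[j]]; rewrite negb_imply -leqNgt => /andP[ij Nji].
  apply: (@determinant_alternate _ _ _ i j); first by rewrite -val_eqE ltn_eqF.
  have Nij : N i = N j by apply/eqP; rewrite eqn_leq Nji mN// ltnW.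
  by move=> k; rewrite !mxE Nij.
have {}smN : {homo N : i j / (i < j)%N >-> (i < j)%N}.
  by move=> i j ij; exact: (implyP (forallP (forallP smN i) j)).
have Nlow (j : 'I_n.+1) : (N ord0 + j <= N j)%N.
  by have := homo_ltn_leqD smN (leq0n j : (@ord0 n <= j)%N); rewrite subn0.
have Nup (j : 'I_n.+1) : (N j + (n - j) <= N ord_max)%N.
  exact: (homo_ltn_leqD smN (leq_ord j : (j <= @ord_max n)%N)).
(* If [N] started above 0, the bounds from both ends would force N j = j + 1 throughout, a case
   already excluded. Symmetrically, stopping short of n + 1 would force N j = j. *)
have /eqP N00 : N ord0 == 0%N.
  apply: contraNT N1; rewrite -lt0n => Ngt0; apply/forallP => j.
  rewrite eqn_leq; apply/andP; split; last first.
    by apply: leq_trans (Nlow j); rewrite -add1n leq_add2r.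
  have := leq_trans (Nup j) (leN ord_max).
  rewrite -(leq_add2r (n - j) (N j) j.+1) => /leq_trans; apply.
  by rewrite addSn subnKC// -ltnS.
have /eqP Nn : N ord_max == n.+1.
  rewrite eqn_leq leN ltnNge; apply: contra N0 => Nle; apply/forallP => j.
  have := Nlow j; rewrite N00 add0n eqn_leq => ->; rewrite andbT.
  have := leq_trans (Nup j) Nle.
  by rewrite -(leq_add2r (n - j) (N j) j) => /leq_trans; apply;
    rewrite subnKC// -ltnS.
have n0 : ord0 != ord_max :> 'I_n.+1.
  by apply/eqP => /(congr1 N); rewrite N00 Nn.
(* Proportionality is expressed by multilinearity: the last row of [A] is [w] times that of [B], and
   [B] has ones in its first and last rows. *)
pose B := \matrix_(j, k) (if j == ord_max then 1 else A j k).
rewrite (@determinant_multilinear _ _ A B B ord_max w 0).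
- rewrite mul0r addr0 (@determinant_alternate _ _ B ord0 ord_max) ?mulr0//.
  by move=> k; rewrite !mxE (negbTE n0) eqxx N00.
- by apply/rowP => k; rewrite !mxE eqxx Nn ltn_ord mulr1 mul0r addr0.
- by apply/matrixP => i j; rewrite !mxE eq_sym (negbTE (neq_lift _ _)).
- by apply/matrixP => i j; rewrite !mxE eq_sym (negbTE (neq_lift _ _)).
Qed.

(** * Phases and chords on the unit circle *)

Section phases.
Context (R : realType).
Implicit Types s t a b : R.

Lemma cis0 : cis (0 : R) = 1.
Proof. by rewrite /cis cos0 sin0. Qed.

Lemma cisD s t : cis (s + t) = cis s * cis t.
Proof.
by rewrite /cis cosD sinD; apply/eqP; rewrite eq_complex/= eqxx/=; apply/eqP; ring.
Qed.

Lemma cis_pi : cis (pi : R) = -1.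
Proof. by rewrite /cis cospi sinpi; apply/eqP; rewrite eq_complex/= oppr0 !eqxx. Qed.

Lemma cis_sum (I : Type) (r : seq I) (P : pred I) (F : I -> R) :
  cis (\sum_(i <- r | P i) F i) = \prod_(i <- r | P i) cis (F i).
Proof. exact: (big_morph _ cisD cis0). Qed.

Lemma cis_natM k t : cis (k%:R * t) = cis t ^+ k.
Proof.
elim: k => [|k IH]; first by rewrite mul0r cis0 expr0.
by rewrite -natr1 mulrDl mul1r cisD IH exprSr.
Qed.

Lemma cisNK t : cis t * cis (- t) = 1.
Proof. by rewrite -cisD subrr cis0. Qed.

Lemma normc_cis t : Normc.normc (cis t) = 1.
Proof. by rewrite /= cos2Dsin2 sqrtr1. Qed.

(** Around the midpoint u with half-difference h, this is e^(iu) (e^(ih) - e^(-ih)) = 2 i sin(h)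
    e^(iu); [0 +i* 1] is the imaginary unit. *)
Lemma cisB a b : cis b - cis a =
  (2 * sin ((b - a) / 2))%:C * (0 +i* 1) * cis ((a + b) / 2).
Proof.
set u := (a + b) / 2; set h := (b - a) / 2.
have -> : b = u + h by rewrite /u /h; field.
have -> : a = u - h by rewrite /u /h; field.
rewrite !cisD /cis cosN sinN; apply/eqP; rewrite eq_complex/=.
by apply/andP; split; apply/eqP; ring.
Qed.

(** The half-difference lies in [0, pi], where the sine is nonnegative, so no absolute value
    remains. *)
Lemma chord_length a b : 0 <= b - a <= 2 * pi ->
  Normc.normc (cis a - cis b) = 2 * sin ((b - a) / 2).
Proof.
move=> /andP[ab0 ab1].
have s0 : 0 <= sin ((b - a) / 2).
  by apply: sin_ge0_pi; apply/andP; split; lra.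
rewrite -[cis a - cis b]opprB normcN cisB !Normc.normcM normc_cis.
rewrite [Normc.normc (_%:C)]/= [Normc.normc (0 +i* 1)]/=.
rewrite !expr0n/= expr1n addr0 add0r sqrtr1 !mulr1 sqrtr_sqr ger0_norm//.
by rewrite mulr_ge0.
Qed.

Lemma cisB_chord a b : 0 <= b - a <= 2 * pi -> cis b - cis a =
  (Normc.normc (cis a - cis b))%:C * (0 +i* 1) * cis ((a + b) / 2).
Proof. by move=> ab; rewrite chord_length// cisB. Qed.

End phases.

(** An index is the smaller member of some pairs and the larger member of others, n - 1 pairs in
    all. *)
Lemma sum_pairs (R : comPzRingType) n (a : 'I_n -> R) :
  \sum_(l < n) \sum_(p < n | (l < p)%N) (a l + a p) = n.-1%:R * \sum_(l < n) a l.
Proof.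
transitivity (\sum_(l < n) \sum_(p < n | p != l) a l); last first.
  rewrite mulr_sumr; apply: eq_bigr => l _.
  rewrite sumr_const mulr_natl; congr (_ *+ _).
  by rewrite cardC1 card_ord.
under eq_bigr do rewrite big_split/=.
rewrite big_split/= [X in _ + X](exchange_big_dep xpredT)//=.
rewrite -big_split/=; apply: eq_bigr => l _.
rewrite [RHS](bigID (fun p : 'I_n => (l < p)%N))/=.
congr (_ + _); apply: eq_bigl => p; rewrite -val_eqE/=.
  by case: ltngtP.
by rewrite -leqNgt; case: ltngtP.
Qed.

(** * The two boundary determinants *)

Section boundary_determinants.
Context (R : realType) (n : nat).
Implicit Type x : conf R n.

Lemma angles_ge0 x j : 0 <= tnth (angles x) j.
Proof. by have /andP[/forallP/(_ j)/andP[]] := valP x. Qed.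

Lemma angles_lt2pi x j : tnth (angles x) j < 2 * pi.
Proof. by have /andP[/forallP/(_ j)/andP[]] := valP x. Qed.

Lemma angles_le x (j k : 'I_n) : (j <= k)%N -> tnth (angles x) j <= tnth (angles x) k.
Proof. by have /andP[_ /forallP/(_ j)/forallP/(_ k)/implyP] := valP x. Qed.

(** This is z^(n (n - 1) / 2), kept as a product over pairs so that it merges with the product
    defining [Delta]. It is taken at i and -i, whose contributions cancel in
    [det_boundary_levels]. *)
Definition half_turns (z : R[i]) : R[i] :=
  \prod_(l < n) \prod_(p < n | (l < p)%N) z.

Lemma half_turnsM (z z' : R[i]) : half_turns z * half_turns z' = half_turns (z * z').
Proof.
by rewrite -big_split/=; apply: eq_bigr => l _; rewrite -big_split.
Qed.

Lemma prod_cis_mid x : \prod_(l < n) \prod_(p < n | (l < p)%N)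
   cis ((tnth (angles x) l + tnth (angles x) p) / 2) =
  cis ((n.-1%:R / 2) * \sum_(j < n) tnth (angles x) j).
Proof.
under eq_bigr do rewrite -cis_sum.
rewrite -cis_sum; congr cis.
rewrite -mulrAC -sum_pairs mulr_suml; apply: eq_bigr => l _.
by rewrite mulr_suml.
Qed.

(** As the angles are sorted, [cisB_chord] applies to each pair: the chords multiply to [Delta],
    each pair gives a factor i, and the midpoints add up through [sum_pairs]. *)
Lemma Vandermonde_angles x :
  \prod_(l < n) \prod_(p < n | (l < p)%N)
    (cis (tnth (angles x) p) - cis (tnth (angles x) l)) =
  (Delta x)%:C * half_turns (0 +i* 1) *
  cis ((n.-1%:R / 2) * \sum_(j < n) tnth (angles x) j).
Proof.
rewrite -prod_cis_mid /Delta rmorph_prod -!big_split/=.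
apply: eq_bigr => l _; rewrite rmorph_prod -!big_split/=.
apply: eq_bigr => p lp; rewrite cisB_chord//.
have := angles_le x (ltnW lp); have := angles_ge0 x l; have := angles_lt2pi x p.
by move=> ? ? ?; apply/andP; split; lra.
Qed.

Lemma conjc_cis (t : R) : (cis t)^*%C = cis (- t).
Proof. by rewrite /cis cosN sinN. Qed.

Lemma det_first_level x :
  \det (\matrix_(j < n, k < n) cis (j%:R * tnth (angles x) k)) =
  (Delta x)%:C * half_turns (0 +i* 1) *
  cis ((n.-1%:R / 2) * \sum_(j < n) tnth (angles x) j).
Proof.
rewrite -Vandermonde_angles.
transitivity (\det (Vandermonde n (\row_k cis (tnth (angles x) k)))).
  by congr (\det _); apply/matrixP => j k; rewrite !mxE cis_natM.
by rewrite det_Vandermonde; do 2 (apply: eq_bigr => ? _); rewrite !mxE.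
Qed.

(** Up to transposition, this is the complex conjugate of the Vandermonde matrix of the first
    level. *)
Lemma det_last_level x :
  \det (\matrix_(j < n, k < n) cis (- (tnth (angles x) j * k%:R))) =
  (Delta x)%:C * half_turns (0 +i* -1) *
  cis (- ((n.-1%:R / 2) * \sum_(j < n) tnth (angles x) j)).
Proof.
transitivity ((\prod_(l < n) \prod_(p < n | (l < p)%N)
    (cis (tnth (angles x) p) - cis (tnth (angles x) l)))^*%C); last first.
  rewrite Vandermonde_angles !rmorphM; congr (_ * _ * _).
  - by apply/eqP; rewrite eq_complex/= oppr0 !eqxx.
  - rewrite rmorph_prod; apply: eq_bigr => l _; rewrite rmorph_prod.
    by apply: eq_bigr => p _; apply/eqP; rewrite eq_complex/= !eqxx.
  - exact: conjc_cis.
rewrite -det_tr.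
transitivity (\det (Vandermonde n (\row_k cis (- tnth (angles x) k)))).
  congr (\det _); apply/matrixP => j k; rewrite !mxE -cis_natM; congr cis.
  by rewrite mulrN mulrC.
rewrite det_Vandermonde rmorph_prod; apply: eq_bigr => l _.
rewrite rmorph_prod; apply: eq_bigr => p _.
by rewrite !mxE rmorphB -!conjc_cis.
Qed.

Lemma det_boundary_levels x y :
  \det (\matrix_(j < n, k < n) cis (j%:R * tnth (angles x) k)) *
  \det (\matrix_(j < n, k < n) cis (- (tnth (angles y) j * k%:R))) =
  (Delta x * Delta y)%:C *
  cis (- ((n.-1%:R / 2) *
     \sum_(j < n) (tnth (angles y) j - tnth (angles x) j))).
Proof.
have K : half_turns (0 +i* 1) * half_turns (0 +i* -1) = 1.
  rewrite half_turnsM; apply: big1 => l _; apply: big1 => p _.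
  by apply/eqP; rewrite eq_complex/=; apply/andP; split; apply/eqP; ring.
rewrite det_first_level det_last_level rmorphM/= sumrB mulrBr opprB cisD.
by rewrite -[RHS]mulr1 -K; ring.
Qed.

End boundary_determinants.

(** * The determinant of one transition *)

Section step_determinant.
Context (R : realType).

Lemma mod2pi_id (u : R) : 0 <= u < 2 * pi -> mod2pi u = u.
Proof.
move=> /andP[u0 u1]; have p0 : 0 < 2 * pi :> R by rewrite mulr_gt0// pi_gt0.
rewrite /mod2pi (@floor_def _ _ 0) ?mulr0 ?subr0//.
by rewrite add0r divr_ge0 ?(ltW p0)//= ltr_pdivrMr// mul1r.
Qed.

Lemma mod2pi_neg (u : R) : - (2 * pi) <= u < 0 -> mod2pi u = u + 2 * pi.
Proof.
move=> /andP[u0 u1]; have p0 : 0 < 2 * pi :> R by rewrite mulr_gt0// pi_gt0.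
rewrite /mod2pi (@floor_def _ _ (-1)) ?mulrN1 ?opprK//.
by rewrite addNr ler_pdivlMr// mulN1r u0 ltr_pdivrMr// mul0r.
Qed.

Context (n : nat) (q : R).
Hypotheses (q_gt0 : 0 < q) (q_neq1 : q != 1).
Implicit Types s t u : R.

(* Q^t and Q^(2 pi), for configurations of n + 1 points. *)
Definition twisted_pow t : R[i] := (q `^ t)%:C * cis (t * (n%:R / 2)).
Definition monodromy : R := (-1) ^+ n * q `^ (2 * pi).

Lemma twisted_powD s t : twisted_pow (s + t) = twisted_pow s * twisted_pow t.
Proof.
rewrite /twisted_pow powRD; last by rewrite (gt_eqF q_gt0) implybT.
by rewrite mulrDl cisD rmorphM/=; ring.
Qed.

Lemma twisted_pow0 : twisted_pow 0 = 1.
Proof. by rewrite /twisted_pow powRr0 mul0r cis0 mulr1. Qed.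

(** Over a full turn the phase is n pi, which leaves only the sign (-1)^n: Q^(2 pi) is real. *)
Lemma twisted_pow2pi : twisted_pow (2 * pi) = monodromy%:C.
Proof.
rewrite /twisted_pow /monodromy mulrC rmorphM/= rmorphXn rmorphN rmorph1.
by rewrite -cis_pi -cis_natM; congr (cis _ * _); field.
Qed.

(** For odd [n] the subtracted term is negative; for even [n], q^(2 pi) = 1 would give 2 pi ln q =
    0. This is where [q != 1] enters. *)
Lemma monodromy_neq1 : 1 - monodromy != 0.
Proof.
rewrite /monodromy -signr_odd; case: (odd n); rewrite ?expr0 ?expr1.
  by rewrite mulN1r opprK gt_eqF// addr_gt0// powR_gt0.
rewrite mul1r subr_eq0 eq_sym; apply: contra q_neq1 => /eqP/(congr1 (@ln R)).
rewrite ln_powR ln1 => /eqP; rewrite mulf_eq0 gt_eqF ?mulr_gt0 ?pi_gt0//=.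
by rewrite ln_eq0.
Qed.

(** Since b - a lies in (-2 pi, 2 pi), reduction modulo 2 pi adds 2 pi exactly when b < a, at the
    price of a factor Q^(2 pi). *)
Lemma f_q_circle a b : 0 <= a < 2 * pi -> 0 <= b < 2 * pi ->
  f_q n.+1 q (b - a) = twisted_pow b * twisted_pow (- a) / (1 - monodromy)%:C *
    (if b < a then monodromy%:C else 1).
Proof.
move=> /andP[a0 a1] /andP[b0 b1]; rewrite -twisted_powD.
case: ltP => ab.
  rewrite mulrAC -twisted_pow2pi -twisted_powD /f_q mod2pi_neg//.
  by apply/andP; split; lra.
by rewrite mulr1 /f_q mod2pi_id//; apply/andP; split; lra.
Qed.

Implicit Types y z : conf R n.+1.

Definition count_below z a : nat := #|[pred k | tnth (angles z) k < a]|.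

(** The angles of [z] are sorted, so those below [a] occupy an initial segment of the indices,
    determined by its cardinality. *)
Lemma count_belowP z a k : (tnth (angles z) k < a) = (k < count_below z a)%N.
Proof.
have card_ltn (m : nat) : (m <= n.+1)%N -> #|[pred l : 'I_n.+1 | (l < m)%N]| = m.
  move=> mn; rewrite -sum1_card -(big_ord_widen _ (fun=> 1%N))// sum1_card.
  exact: card_ord.
apply/idP/idP => [zk|].
  rewrite -[X in (X <= _)%N]card_ltn//; apply/subset_leq_card/fintype.subsetP => l.
  rewrite !inE ltnS => lk; apply: le_lt_trans zk; exact: angles_le.
apply: contraTT; rewrite -leqNgt => zk; rewrite -[leqRHS]card_ltn; last exact/ltnW.
apply/subset_leq_card/fintype.subsetP => l; rewrite !inE => zl.
by rewrite ltnNge; apply: contra zk => kl; exact: le_lt_trans (angles_le _ kl) zl.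
Qed.

Lemma count_below_le z a : (count_below z a <= n.+1)%N.
Proof. by rewrite -[leqRHS](card_ord n.+1) max_card. Qed.

(** With indices from 0, a count of j says b_(j-1) < a_j <= b_j, which is one link of the
    interlacing chain. This matches the first case of [det_staircase]. *)
Lemma interlace_upE y z : interlace_up (angles y) (angles z) =
  [forall j : 'I_n.+1, count_below z (tnth (angles y) j) == j].
Proof.
apply/andP/forallP => [[/forallP up1 /forallP up2] j|N].
  rewrite eqn_leq leqNgt -count_belowP -leNgt up1/=.
  case: j => [[//|j] jn]; have jn' := ltnW jn.
  by have /forallP/(_ (Ordinal jn)) := up2 (Ordinal jn'); rewrite eqxx/= count_belowP.
split; apply/forallP => j.
  by rewrite leNgt count_belowP (eqP (N j)) ltnn.
apply/forallP => k; apply/implyP => /eqP kj.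
by rewrite count_belowP (eqP (N k)) kj.
Qed.

(** Now a count of j + 1 says b_j < a_j <= b_(j+1), the upper bound being void for the last j; this
    is the second case of [det_staircase]. *)
Lemma interlace_downE y z : interlace_down (angles y) (angles z) =
  [forall j : 'I_n.+1, count_below z (tnth (angles y) j) == j.+1].
Proof.
apply/andP/forallP => [[/forallP dn1 /forallP dn2] j|N].
  rewrite eqn_leq -count_belowP dn1 andbT.
  have [jn|nj] := ltnP j.+1 n.+1; last exact: leq_trans (count_below_le _ _) nj.
  have /forallP/(_ (Ordinal jn)) := dn2 j; rewrite eqxx/= leNgt count_belowP/=.
  by rewrite -leqNgt.
split; apply/forallP => j.
  by rewrite count_belowP (eqP (N j)).
apply/forallP => k; apply/implyP => /eqP kj.
by rewrite leNgt count_belowP (eqP (N j)) kj ltnn.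
Qed.

Lemma det_step y z :
  \det (\matrix_(j < n.+1, k < n.+1)
    f_q n.+1 q (tnth (angles z) k - tnth (angles y) j)) =
  ((1 - monodromy)^-1 * I_q q y z)%:C *
  cis ((n%:R / 2) * \sum_(j < n.+1) (tnth (angles z) j - tnth (angles y) j)).
Proof.
set a := angles y; set b := angles z; set s := \sum_(j < _) _.
pose D : R[i] := (1 - monodromy)%:C.
have D0 : D != 0 by rewrite eq_complex/= negb_and monodromy_neq1.
have DE : 1 - monodromy%:C = D by rewrite /D rmorphB.
pose N j := count_below z (tnth a j).
(* Row factors Q^(-a_j) / D and column factors Q^(b_k) are pulled out, leaving a staircase
   matrix. *)
have -> : \matrix_(j < n.+1, k < n.+1) f_q n.+1 q (tnth b k - tnth a j) =
    diag_mx (\row_j (twisted_pow (- tnth a j) / D)) *m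
    (\matrix_(j < n.+1, k < n.+1) (if (k < N j)%N then monodromy%:C else 1)) *m
    diag_mx (\row_k twisted_pow (tnth b k)).
  apply/matrixP => j k; rewrite mul_mx_diag mul_diag_mx !mxE f_q_circle.
  - rewrite /N -count_belowP -/D; case: ifP => _;
      move: (twisted_pow _) (twisted_pow _) => u v; ring.
  - by rewrite angles_ge0 angles_lt2pi.
  - by rewrite angles_ge0 angles_lt2pi.
have tE : (\prod_j (twisted_pow (- tnth a j) / D)) * \prod_k twisted_pow (tnth b k) =
    twisted_pow s / D ^+ n.+1.
  have -> : twisted_pow s = \prod_j twisted_pow (tnth b j - tnth a j).
    by rewrite /s; apply: (big_morph _ twisted_powD twisted_pow0).
  under [in RHS]eq_bigr do rewrite twisted_powD.
  by rewrite !big_split/= prodr_const card_ord exprVn; ring.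
rewrite !det_mulmx !det_diag.
under eq_bigr do rewrite mxE.
under [X in _ * X]eq_bigr do rewrite mxE.
rewrite mulrAC tE det_staircase; last 2 first.
- move=> i j ij; apply/subset_leq_card/fintype.subsetP => k; rewrite !inE => /lt_le_trans.
  by apply; exact: angles_le.
- by move=> j; exact: count_below_le.
rewrite -interlace_upE -interlace_downE DE /I_q /interlace /winding -/a -/b -/s.
(* The n powers of [D] from the staircase meet the n + 1 from the rows. *)
have Dn : D ^+ n / D ^+ n.+1 = D^-1.
  by rewrite exprS invfM mulrCA divff ?mulr1// expf_neq0.
rewrite (_ : forall u, ((1 - monodromy)^-1 * u)%:C = D^-1 * u%:C); last first.
  move=> u. by rewrite rmorphM fmorphV.
have [up|nup] := boolP (interlace_up a b).
  (* Every b_j - a_j is nonnegative here, so the winding is [s] itself. *)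
  rewrite mulrAC -mulrA Dn /= ifT; last first.
    by apply: sumr_ge0 => j _; rewrite subr_ge0; case/andP: up => /forallP.
  by rewrite /twisted_pow [s * _]mulrC; ring.
have [dn|ndn] := boolP (interlace_down a b); last by rewrite /= !mulr0 mul0r.
have {}dn j : tnth b j - tnth a j < 0.
  by case/andP: dn => /forallP/(_ j) dn _; rewrite subr_lt0.
(* The sum is strictly negative because there is at least one point; the winding is therefore s + 2
   pi. *)
have s0 : s < 0.
  rewrite -[ltRHS](@big1_eq _ 0 +%R _ (index_enum 'I_n.+1) predT) ltr_sum//.
  by apply/hasP; exists ord0; rewrite ?mem_index_enum.
rewrite /= leNgt s0/= powRD ?(gt_eqF q_gt0) ?implybT//.
rewrite -[D^-1]Dn /twisted_pow /monodromy [s * _]mulrC.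
have -> : ((-1) ^+ n * q `^ (2 * pi))%:C = (-1) ^+ n * (q `^ (2 * pi))%:C.
  by rewrite rmorphM rmorphXn rmorphN rmorph1.
(* The sign of the staircase determinant cancels the one in [monodromy]; the remaining q^(2 pi)
   completes q^s to q^(s + 2 pi). *)
have sgn : (-1) ^+ n * (-1) ^+ n = 1 :> R[i] by rewrite -exprMn mulrNN mulr1 expr1n.
have -> : (q `^ s * q `^ (2 * pi))%:C = (q `^ s)%:C * (q `^ (2 * pi))%:C.
  by rewrite rmorphM.
rewrite [(-1) ^+ n * (_ * _)]mulrA sgn mul1r.
by move: (cis _) (q `^ s)%:C (q `^ _)%:C (D ^+ n) (D ^+ n.+1)^-1 => *; ring.
Qed.

End step_determinant.

(** * Integration against a measure with a density *)

Section density.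
Import HBNNSimple.
Local Open Scope ereal_scope.
Context d (T : measurableType d) (R : realType).
Variables (mu nu : {measure set T -> \bar R}) (g : T -> R).
Hypotheses (g0 : forall x, (0 <= g x)%R) (mg : measurable_fun setT g).
Hypothesis nuE : forall A, measurable A -> nu A = \int[mu]_(x in A) (g x)%:E.

Let mge : measurable_fun setT (EFin \o g).
Proof. exact/measurable_EFinP. Qed.

(** A simple function is a finite combination of indicators of its level sets, and for indicators
    the claim is [nuE]. *)
Lemma nnsfun_integral_density (h : {nnsfun T >-> R}) :
  \int[nu]_x (h x)%:E = \int[mu]_x ((g x)%:E * (h x)%:E).
Proof.
pose c (r : R) x : R := (r * \1_(h @^-1` [set r]) x)%R.
have hE x : (h x)%:E = \sum_(r \in range h) (c r x)%:E.
  by rewrite fsumEFin// -fimfunE.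
have mc r : measurable_fun setT (fun x => (c r x)%:E).
  by apply/measurable_EFinP; exact: measurable_funM.
have c0 r x : 0 <= (c r x)%:E by rewrite nnfun_muleindic_ge0.
under eq_integral do rewrite hE.
rewrite ge0_integral_fsum//.
under [RHS]eq_integral do rewrite hE ge0_mule_fsumr//.
rewrite ge0_integral_fsum//; last 2 first.
  by move=> r; exact: emeasurable_funM.
  by move=> r x _; rewrite mule_ge0// lee_fin.
apply: eq_fsbigr => r /set_mem[x _ <-].
under eq_integral do rewrite EFinM.
rewrite ge0_integralZl_EFin//; last exact/measurable_EFinP.
rewrite integral_indic// setIT nuE// integral_mkcond -ge0_integralZl_EFin//; last 2 first.
- by move=> y _; rewrite /patch; case: ifP => // _; rewrite lee_fin.
- by apply/measurable_restrict => //; exact: measurable_funS mge.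
apply: eq_integral => y _; rewrite /c patchE indicE.
by case: (y \in _); rewrite ?mulr1 ?mulr0 ?mule0// muleC.
Qed.

(** Monotone convergence along simple functions increasing to [f], under [nu] and, after
    multiplication by [g], under [mu]. *)
Lemma ge0_integral_density (f : T -> \bar R) :
  (forall x, 0 <= f x) -> measurable_fun setT f ->
  \int[nu]_x f x = \int[mu]_x ((g x)%:E * f x).
Proof.
move=> f0 mf; pose h := nnsfun_approx measurableT mf.
have hf x : (h n x)%:E @[n --> \oo] --> f x by exact: cvg_nnsfun_approx.
have ndh x : {homo (fun n => (h n x)%:E) : a b / (a <= b)%N >-> a <= b}.
  by move=> a b ab; rewrite lee_fin; exact/lefP/nd_nnsfun_approx.
transitivity (limn (fun n => \int[nu]_x (h n x)%:E)).
  rewrite -monotone_convergence//.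
  - by apply: eq_integral => x _; apply/esym/cvg_lim.
  - by move=> n; exact/measurable_EFinP.
  - by move=> n x _; rewrite lee_fin.
under eq_fun do rewrite nnsfun_integral_density.
rewrite -monotone_convergence//.
- apply: eq_integral => x _; apply: cvg_lim => //.
  by apply: cvgeZl.
- by move=> n; apply: emeasurable_funM => //; exact/measurable_EFinP.
- by move=> n x _; rewrite mule_ge0// lee_fin.
- by move=> x _ a b ab; rewrite lee_wpmul2l ?lee_fin//; exact: ndh.
Qed.

End density.

(** * Chain laws with a transition density *)

Section ksnd.
Context d d' d'' (X : measurableType d) (Y : measurableType d')
  (Z : measurableType d'') (R : realType) (k : R.-fker Y ~> Z).

(** The chain continues from its latest state, the second component, while earlier data are carried
    along as a parameter. *)
Definition ksnd (p : X * Y) : {measure set Z -> \bar R} := k p.2.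

Let measurable_ksnd U : measurable U -> measurable_fun setT (ksnd ^~ U).
Proof.
by move=> mU; exact: (measurableT_comp (measurable_kernel k _ mU) measurable_snd).
Qed.

HB.instance Definition _ :=
  isKernel.Build _ _ (X * Y)%type Z R ksnd measurable_ksnd.

Let ksnd_uub : measure_fam_uub ksnd.
Proof. by have [r kr] := measure_uub k; exists r => p; exact: kr. Qed.

HB.instance Definition _ := Kernel_isFinite.Build _ _ _ _ R ksnd ksnd_uub.

End ksnd.

Section chain_density.
Local Open Scope ereal_scope.
Context d (T : measurableType d) (R : realType).

Lemma chain_law_ge0 (k : T -> {measure set T -> \bar R})
  (nu : {measure set T -> \bar R}) n (A : set (n.-tuple T)) : 0 <= chain_law k nu A.
Proof.
elim: n nu A => [|n IH] nu A /=; first exact: measure_ge0.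
by apply: integral_ge0 => x _; exact: IH.
Qed.

(** The parameter space [Y] and the kernel [l] are arbitrary so that the induction can move the
    first state of the tuple into the parameter, replacing [Y] by [Y * T] and [l] by [ksnd k]. *)
Lemma measurable_chain_law (k : R.-fker T ~> T) n d' (Y : measurableType d')
    (l : R.-fker Y ~> T) (A : set (Y * n.-tuple T)) : measurable A ->
  measurable_fun setT (fun y => chain_law k (l y) [set t | A (y, t)]).
Proof.
elim: n d' Y l A => [|n IH] d' Y l A mA /=.
  rewrite (_ : (fun _ => _) = (fun y => (\1_A (y, [tuple]))%:E)); last first.
    by apply/funext => y; rewrite diracE indicE; congr (_%:R%:E);
      apply/idP/idP; rewrite !inE.
  apply/measurable_EFinP.
  have m1 : measurable_fun setT (\1_A : _ -> R) by exact: measurable_indic.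
  apply: (measurableT_comp m1).
  exact: measurable_fun_pair.
pose A' := [set p : (Y * T) * n.-tuple T | A (p.1.1, tcons (p.1.2, p.2))].
have mA' : measurable A'.
  rewrite -[A']setTI.
  have mc : measurable_fun setT
    (fun p : (Y * T) * n.-tuple T => (p.1.1, tcons (p.1.2, p.2))).
    apply: measurable_fun_pair => /=.
      exact: (measurableT_comp measurable_fst measurable_fst).
    apply: measurable_cons measurable_snd.
    exact: (measurableT_comp measurable_snd measurable_fst).
  exact: mc.
have mh := IH _ _ (ksnd k : R.-fker (Y * T)%type ~> T) A' mA'.
apply: (measurable_fun_integral_finite_kernel
  (fun p : Y * T => chain_law k (k p.2) [set t | A (p.1, tcons (p.2, t))])) => //.
by move=> p; exact: chain_law_ge0.
Qed.

Variables (mu : {sigma_finite_measure set T -> \bar R}).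

(** The power measure is a pushforward of a product measure, so this is Tonelli for [f] cut off
    outside [A]. *)
Lemma integral_power_measureS n (A : set (n.+1.-tuple T))
  (f : n.+1.-tuple T -> \bar R) :
  measurable A -> measurable_fun setT f -> (forall t, 0 <= f t) ->
  \int[power_measure mu n.+1]_(t in A) f t =
  \int[mu]_x \int[power_measure mu n]_(t in [set t | A (tcons (x, t))]) f (tcons (x, t)).
Proof.
move=> mA mf f0.
have mfA : measurable_fun setT (f \_ A).
  by apply/(measurable_restrictT f mA); exact: measurable_funS mf.
have fA0 t : 0 <= (f \_ A) t by rewrite patchE; case: ifP.
rewrite integral_mkcond.
transitivity (\int[pushforward (mu \x power_measure mu n) (@tcons T n)]_t (f \_ A) t).
  by [].
rewrite ge0_integral_pushforward//; last exact: measurable_tcons.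
rewrite preimage_setT fubini_tonelli1/=; last 2 first.
- exact: (measurableT_comp mfA (@measurable_tcons _ _ _)).
- by move=> p; exact: fA0.
apply: eq_integral => x _; rewrite /fubini_F [RHS]integral_mkcond.
by apply: eq_integral => t _; rewrite /= !patchE.
Qed.

Variables (p : T -> T -> R) (good : pred T) (k : R.-fker T ~> T).
Hypotheses (p0 : forall y z, (0 <= p y z)%R)
  (mp : measurable_fun setT (fun yz : T * T => p yz.1 yz.2))
  (p_good : forall y z, ~~ good z -> p y z = 0%R)
  (kE : forall y, good y -> forall A, measurable A ->
    k y A = \int[mu]_(z in A) (p y z)%:E).

Fixpoint path_density (y : T) (s : seq T) : R :=
  if s is z :: s' then p y z * path_density z s' else 1%R.

Lemma path_density_ge0 y s : (0 <= path_density y s)%R.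
Proof. by elim: s y => [|z s IH] y//=; exact: mulr_ge0. Qed.

Lemma measurable_path_density n :
  measurable_fun setT (fun q : T * n.-tuple T => path_density q.1 q.2).
Proof.
elim: n => [|n IH].
  by rewrite (_ : (fun _ => _) = cst 1%R)//; apply/funext => -[y t]; rewrite tuple0.
rewrite (_ : (fun _ => _) = (fun q : T * n.+1.-tuple T =>
   p q.1 (tnth q.2 ord0) * path_density (tnth q.2 ord0) (behead q.2))%R); last first.
  by apply/funext => -[y t] /=; case/tupleP: t => x t; rewrite /= tnth0.
have mt : measurable_fun setT (fun q : T * n.+1.-tuple T => tnth q.2 ord0).
  exact: (measurableT_comp (measurable_tnth ord0) measurable_snd).
apply: measurable_funM.
  apply: (measurableT_comp mp (f := fun yz => p yz.1 yz.2)
    (g := fun q : T * n.+1.-tuple T => (q.1, tnth q.2 ord0))).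
  exact: measurable_fun_pair.
apply: (measurableT_comp IH
    (g := fun q : T * n.+1.-tuple T => (tnth q.2 ord0, [tuple of behead q.2]))).
apply: measurable_fun_pair => //.
exact: (measurableT_comp (@measurable_behead _ T n) measurable_snd).
Qed.

(** The initial density is arbitrary so that the lemma serves both the induction, with [nu] equal to
    [k y] and [g] equal to [p y], and the actual initial law. *)
Lemma chain_law_densityS (nu : {measure set T -> \bar R}) (g : T -> R) n :
  (forall x, (0 <= g x)%R) -> measurable_fun setT g ->
  (forall x, ~~ good x -> g x = 0%R) ->
  (forall A, measurable A -> nu A = \int[mu]_(x in A) (g x)%:E) ->
  (forall y (A : set (n.-tuple T)), good y -> measurable A ->
     chain_law k (k y) A =
     \int[power_measure mu n]_(t in A) (path_density y t)%:E) ->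
  forall A : set (n.+1.-tuple T), measurable A ->
  chain_law k nu A = \int[power_measure mu n.+1]_(t in A)
    (g (thead t) * path_density (thead t) (behead t))%:E.
Proof.
move=> g0 mg g_good nuE IH A mA /=.
have mpd : measurable_fun setT (fun t : n.+1.-tuple T =>
    g (thead t) * path_density (thead t) (behead t))%R.
  apply: measurable_funM.
    by apply: (measurableT_comp mg); exact: measurable_tnth.
  apply: (measurableT_comp (@measurable_path_density n)
    (g := fun t : n.+1.-tuple T => (thead t, [tuple of behead t]))).
  by apply: measurable_fun_pair; [exact: measurable_tnth|exact: measurable_behead].
rewrite integral_power_measureS//; last 2 first.
- exact/measurable_EFinP.
- by move=> t; rewrite lee_fin mulr_ge0// path_density_ge0.
have mA' : measurable [set q : T * n.-tuple T | A (tcons q)].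
  by rewrite -[X in measurable X]setTI; exact: measurable_tcons.
rewrite (ge0_integral_density g0 mg nuE); last 2 first.
- by move=> x; exact: chain_law_ge0.
- exact: measurable_chain_law mA'.
apply: eq_integral => x _.
have mAx : measurable [set t | A (tcons (x, t))].
  rewrite -[X in measurable X]setTI.
  by apply: (measurable_cons (f := cst x) (g := id)).
have mpx : measurable_fun setT (fun t : n.-tuple T => (path_density x t)%:E).
  apply/measurable_EFinP.
  exact: (measurableT_comp (@measurable_path_density n) (pair1_measurable x)).
transitivity (\int[power_measure mu n]_(t in [set t | A (tcons (x, t))])
    ((g x)%:E * (path_density x t)%:E)); last first.
  by apply: eq_integral => t _; rewrite theadE.
rewrite ge0_integralZl//; last 3 first.
- exact: measurable_funS mpx.
- by move=> t _; rewrite lee_fin path_density_ge0.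
- by rewrite lee_fin.
(* From a bad first state [kE] says nothing about [k], but both sides carry the factor g x = 0. *)
have [gx|/g_good->] := boolP (good x); last by rewrite !mul0e.
by rewrite IH.
Qed.

Lemma chain_law_kernel_density n y (A : set (n.-tuple T)) :
  good y -> measurable A ->
  chain_law k (k y) A = \int[power_measure mu n]_(t in A) (path_density y t)%:E.
Proof.
elim: n y A => [|n IH] y A gy mA.
  rewrite (eq_integral (cst 1)); last by move=> t _; rewrite tuple0.
  by rewrite integral_cst//= mul1e.
rewrite (chain_law_densityS (g := p y))//.
- by apply: eq_integral => t _; case/tupleP: t => x t; rewrite theadE.
- exact: (measurableT_comp mp (pair1_measurable y)).
- by move=> x; exact: p_good.
- exact: kE.
Qed.

Lemma chain_law_density (nu : {measure set T -> \bar R}) (g : T -> R) n :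
  (forall x, (0 <= g x)%R) -> measurable_fun setT g ->
  (forall x, ~~ good x -> g x = 0%R) ->
  (forall A, measurable A -> nu A = \int[mu]_(x in A) (g x)%:E) ->
  forall A : set (n.+1.-tuple T), measurable A ->
  chain_law k nu A = \int[power_measure mu n.+1]_(t in A)
    (g (thead t) * path_density (thead t) (behead t))%:E.
Proof.
move=> g0 mg g_good nuE A mA; apply: chain_law_densityS => // y B.
exact: chain_law_kernel_density.
Qed.

End chain_density.

(** * Sign and measurability of the transition density *)

Section transition_density.
Context (R : realType) (n : nat).
Implicit Types y z : conf R n.

Lemma angles_diff y (l p : 'I_n) : (l < p)%N ->
  0 <= tnth (angles y) p - tnth (angles y) l <= 2 * pi.
Proof.
move=> lp; have := angles_le y (ltnW lp).
have := angles_ge0 y l; have := angles_lt2pi y p.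
by move=> ? ? ?; apply/andP; split; lra.
Qed.

Lemma Delta_ge0 y : 0 <= Delta y.
Proof. by do 2 (apply: prodr_ge0 => ? _); exact: sqrtr_ge0. Qed.

Lemma Delta_le y : Delta y <= \prod_(l < n) \prod_(p < n | (l < p)%N) 2.
Proof.
apply: ler_prod => l _; apply/andP; split.
  by apply: prodr_ge0 => p _; exact: sqrtr_ge0.
apply: ler_prod => p lp; apply/andP; split; first exact: sqrtr_ge0.
rewrite chord_length ?angles_diff//.
by rewrite ler_piMr// sin_le1.
Qed.

Lemma Delta_neq0 y :
  (forall l p : 'I_n, (l < p)%N -> tnth (angles y) l < tnth (angles y) p) ->
  Delta y != 0.
Proof.
move=> incr; apply/prodf_neq0 => l _; apply/prodf_neq0 => p lp.
rewrite chord_length ?angles_diff// mulf_neq0// gt_eqF//.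
have := incr _ _ lp; have := angles_ge0 y l; have := angles_lt2pi y p.
by move=> ? ? ?; apply: sin_gt0_pi; apply/andP; split; lra.
Qed.

(** Two consecutive angles of [y] have an angle of [z] between them, with one strict inequality, so
    the angles of [y] are distinct. Division by [Delta y] is thus genuine wherever [I_q] does not
    vanish. *)
Lemma interlace_Delta_neq0 y z : interlace y z -> Delta y != 0.
Proof.
move=> yz; apply: Delta_neq0 => l p lp.
have ln : (l.+1 < n)%N by exact: leq_ltn_trans lp (ltn_ord p).
pose l' := Ordinal ln.
apply: lt_le_trans (angles_le y (lp : (l' <= p)%N)).
case/orP: yz => /andP[/forallP h1 /forallP h2].
  apply: le_lt_trans (h1 l) _.
  by have /forallP/(_ l')/implyP := h2 l; exact.
apply: le_lt_trans (h1 l').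
by have /forallP/(_ l')/implyP := h2 l; exact.
Qed.

Lemma I_q_ge0 q y z : 0 <= I_q q y z.
Proof. by rewrite /I_q; case: ifP => // _; exact: powR_ge0. Qed.

Lemma tc_q_ge0 q : 0 <= tc_q n q :> R.
Proof.
rewrite /tc_q divr_ge0// /c_q; apply: fine_ge0; apply: integral_ge0 => r _.
by rewrite lee_fin mulr_ge0 ?powR_ge0// exprn_ge0// sqrtr_ge0.
Qed.

Lemma m_q_density_ge0 q y z : 0 <= m_q_density q y z.
Proof.
by rewrite !mulr_ge0 ?invr_ge0 ?tc_q_ge0 ?Delta_ge0 ?I_q_ge0.
Qed.

Let D2 := (conf R n * conf R n)%type.

Lemma measurable_fst_angle j :
  measurable_fun [set: D2] (fun yz => tnth (angles yz.1) j).
Proof.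
exact: (measurableT_comp (measurable_tnth j)
  (measurableT_comp (@measurable_angles R n) measurable_fst)).
Qed.

Lemma measurable_snd_angle j :
  measurable_fun [set: D2] (fun yz => tnth (angles yz.2) j).
Proof.
exact: (measurableT_comp (measurable_tnth j)
  (measurableT_comp (@measurable_angles R n) measurable_snd)).
Qed.

Lemma measurable_forallb d (T : measurableType d) (I : finType) (f : I -> T -> bool) :
  (forall i, measurable_fun setT (f i)) ->
  measurable_fun setT (fun x => [forall i, f i x]).
Proof.
move=> mf.
have -> : (fun x => [forall i, f i x]) =
    (fun x => \big[andb/true]_(i <- index_enum I) f i x).
  by apply/funext => x; rewrite big_andE; apply: eq_forallb.
elim: (index_enum I) => [|i s IH].
  by under eq_fun do rewrite big_nil; exact: measurable_cst.
by under eq_fun do rewrite big_cons; apply: measurable_and.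
Qed.

Lemma measurable_interlace : measurable_fun [set: D2] (fun yz => interlace yz.1 yz.2).
Proof.
have m1 := measurable_fst_angle; have m2 := measurable_snd_angle.
have mi b (f : D2 -> bool) : measurable_fun setT f ->
    measurable_fun setT (fun x => b ==> f x).
  by case: b => //= _; exact: measurable_cst.
apply: measurable_or; apply: measurable_and; apply: measurable_forallb => j.
- exact: measurable_fun_ler.
- by apply: measurable_forallb => k; apply: mi; exact: measurable_fun_ltr.
- exact: measurable_fun_ltr.
- by apply: measurable_forallb => k; apply: mi; exact: measurable_fun_ler.
Qed.

Lemma measurable_winding : measurable_fun [set: D2] (fun yz => winding yz.1 yz.2).
Proof.
have ms : measurable_fun [set: D2] (fun yz =>
    \sum_(j < n) (tnth (angles yz.2) j - tnth (angles yz.1) j)).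
  apply: measurable_sum => j; apply: measurable_funB.
    exact: measurable_snd_angle.
  exact: measurable_fst_angle.
rewrite /winding; apply: measurable_fun_ifT => //.
- by apply: measurable_fun_ler => //; exact: measurable_cst.
- by apply: measurable_funD => //; exact: measurable_cst.
Qed.

Lemma measurable_m_q_density q :
  measurable_fun [set: D2] (fun yz => m_q_density q yz.1 yz.2).
Proof.
apply: measurable_funM; last first.
  rewrite /I_q; apply: measurable_fun_ifT => //.
  - exact: measurable_interlace.
  - exact: (measurableT_comp (measurable_powRr q) measurable_winding).
apply: measurable_funM => //; apply: measurable_funM.
  exact: (measurableT_comp (@measurable_Delta R n) measurable_snd).
(* On nonnegative reals, zero included, inversion agrees with the real power -1. *)
under eq_fun do rewrite -powR_inv1 ?Delta_ge0//.
exact: (measurableT_comp (measurable_powR (-1))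
  (measurableT_comp (@measurable_Delta R n) measurable_fst)).
Qed.

End transition_density.

(** * Finiteness of total masses *)

Section finiteness.
Local Open Scope ereal_scope.

Lemma measurable_tuple_box d (T : measurableType d) n (A : set T) : measurable A ->
  measurable [set t : n.-tuple T | forall j, A (tnth t j)].
Proof.
move=> mA.
rewrite (_ : [set t | _] = \bigcap_(j in [set: 'I_n]) ((@tnth n T)^~ j @^-1` A)).
  apply: fin_bigcap_measurable; first exact: finite_finset.
  by move=> j _; rewrite -[X in measurable X]setTI; exact: measurable_tnth.
by apply/seteqP; split=> t h => [j _|j]; exact: h.
Qed.

Lemma power_measure_box d (T : measurableType d) (R : realType)
    (mu : {sigma_finite_measure set T -> \bar R}) n (A : set T) : measurable A ->
  power_measure mu n [set t | forall j, A (tnth t j)] = mu A ^+ n.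
Proof.
move=> mA; elim: n => [|n IH].
  by rewrite expe0 [LHS]diracE mem_set// => -[].
transitivity ((mu \x power_measure mu n)
    (@tcons T n @^-1` [set t | forall j, A (tnth t j)])); first by [].
rewrite (_ : _ @^-1` _ = A `*` [set t | forall j, A (tnth t j)]).
  rewrite product_measure1E ?expeS//; last exact: measurable_tuple_box.
  by congr (_ * _); rewrite -IH.
apply/seteqP; split=> -[x t] /=.
  move=> h; split; first exact: (h ord0).
  by move=> j; have := h (lift ord0 j); rewrite tnthS.
move=> [Ax At] j; case: (unliftP ord0 j) => [i|] ->; last by [].
by rewrite tnthS; exact: At.
Qed.

Context (R : realType) (n : nat).

Lemma conf_leb_finite : conf_leb [set: conf R n] < +oo.
Proof.
pose A : set R := [set` `[0%R, (2 * pi)%R[].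
have mA : measurable A by exact: measurable_itv.
apply: (@le_lt_trans _ _ (power_measure (@lebesgue_measure R) n
    [set t | forall j, A (tnth t j)])).
  apply: le_measure; rewrite ?inE.
  - exact: measurable_image_angles.
  - exact: measurable_tuple_box.
  by move=> _ [x _ <-] j; rewrite /A/= in_itv/= angles_ge0 angles_lt2pi.
rewrite power_measure_box// [X in X ^+ _](lebesgue_measure_itv `[0%R, (2 * pi)%R[).
by case: ifP => _; rewrite ?sube0 -?EFin_expe ?ltry// expe_fin_num.
Qed.

(** Chords have length at most 2, so the density is bounded, and [conf_leb] is finite because
    configurations lie in the box [0, 2 pi)^n. *)
Lemma conf_haar_finite : conf_haar [set: conf R n] < +oo.
Proof.
pose M : R := ((2 * pi) ^- n * (\prod_(l < n) \prod_(p < n | (l < p)%N) 2) ^+ 2)%R.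
have pi2 : (0 <= (2 * pi : R) ^- n)%R.
  by rewrite invr_ge0 exprn_ge0// mulr_ge0// pi_ge0.
apply: (@le_lt_trans _ _ (\int[@conf_leb R n]_x M%:E)).
  apply: ge0_le_integral => //.
  - by move=> x _; rewrite lee_fin mulr_ge0// sqr_ge0.
  - apply/measurable_EFinP; apply: measurable_funM => //.
    by apply: measurable_funX; exact: measurable_Delta.
  - move=> x _; rewrite lee_fin ler_wpM2l// lerXn2r ?nnegrE ?Delta_ge0 ?Delta_le//.
    exact: le_trans (Delta_ge0 x) (Delta_le x).
rewrite integral_cst//; apply: lte_mul_pinfty => //; last exact: conf_leb_finite.
by rewrite lee_fin mulr_ge0// sqr_ge0.
Qed.

End finiteness.

(** Each transition has mass one, so only the initial mass remains; it yields integrability of the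
    chain density. *)
Lemma chain_law_setT d (T : measurableType d) (R : realType)
    (k : T -> {measure set T -> \bar R}) (nu : {measure set T -> \bar R}) n :
  (forall y, k y setT = 1%E) -> @chain_law _ T R k nu n.+1 setT = nu setT.
Proof.
move=> k1; elim: n nu => [|n IH] nu.
  rewrite /= (eq_integral (cst 1%E)); last by move=> x _; exact: diracT.
  by rewrite integral_cst// mul1e.
transitivity (\int[nu]_x (cst 1 x))%E; last by rewrite integral_cst// mul1e.
apply: eq_integral => x _; rewrite /cst -(k1 x) -[RHS]IH.
by [].
Qed.

(** * Multiplying the determinants of all levels *)

Section product_of_determinants.
Context (R : realType) (n' : nat) (q : R).
Local Notation n := n'.+1.
Hypotheses (q_gt0 : 0 < q) (q_neq1 : q != 1).
Implicit Types (y z : conf R n) (s : seq (conf R n)).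
Local Notation p := (@m_q_density R n q).
Local Notation tc := (tc_q n q : R).
Local Notation w := (monodromy n' q).

Definition step_matrix y z : 'M[R[i]]_n :=
  \matrix_(j, k) f_q n q (tnth (angles z) k - tnth (angles y) j).

(* Each transition density carries Delta(z)/Delta(y), which telescopes, and each
   step determinant carries a phase, which telescopes as well. *)
Lemma prod_det_steps x0 y s :
  (tc ^- size s * Delta (last y s))%:C *
    \prod_(i < size s) \det (step_matrix (nth x0 (y :: s) i) (nth x0 (y :: s) i.+1)) =
  ((1 - w) ^- size s * (Delta y * path_density p y s))%:C *
    cis ((n'%:R / 2) *
      \sum_(j < n) (tnth (angles (last y s)) j - tnth (angles y) j)).
Proof.
elim: s y => [|z s IH] y /=.
  rewrite big_ord0 !expr0 !invr1 !mul1r !mulr1 big1 ?mulr0 ?cis0 ?mulr1//.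
  by move=> j _; rewrite subrr.
have := IH z; set S := (X in cis (_ * X)); set P := (X in _ * X = _ -> _).
move=> {}IH; rewrite big_ord_recl.
rewrite [in X in _ * (X * _) = _]/=.
rewrite -[X in _ * (_ * X) = _]/P.
rewrite det_step//.
set S0 := \sum_(j < n) (tnth (angles z) j - tnth (angles y) j).
have -> : \sum_(j < n) (tnth (angles (last z s)) j - tnth (angles y) j) = S0 + S.
  by rewrite -big_split/=; apply: eq_bigr => j _; ring.
rewrite mulrDr cisD.
have -> : (tc ^- (size s).+1 * Delta (last z s))%:C =
    (tc^-1)%:C * (tc ^- size s * Delta (last z s))%:C.
  by rewrite exprS invfM -mulrA -rmorphM.
transitivity ((tc^-1)%:C * ((1 - w)^-1 * I_q q y z)%:C * cis (n'%:R / 2 * S0) *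
    ((tc ^- size s * Delta (last z s))%:C * P)).
  by rewrite -!mulrA; congr (_ * _); rewrite mulrCA; congr (_ * _); rewrite mulrCA.
rewrite IH.
have -> : (1 - w) ^- (size s).+1 *
    (Delta y * (p y z * path_density p z s)) =
    tc^-1 * ((1 - w)^-1 * I_q q y z) *
    ((1 - w) ^- size s * (Delta z * path_density p z s)).
  move: (path_density p z s) => pd; rewrite /m_q_density exprS invfM.
  (* When [y] and [z] interlace, [Delta y] can be cancelled; otherwise both sides vanish with
     [I_q]. *)
  have [/interlace_Delta_neq0 Dy|nyz] := boolP (interlace y z).
    rewrite -[Delta z in RHS](divfK Dy).
    move: (Delta z / Delta y) (tc^-1) ((1 - w)^-1) => u t v.
    by move: (_ ^- _) => r; ring.
  by rewrite /I_q (negbTE nyz) !(mulr0, mul0r).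
have realM (u v : R) : (u * v)%:C = u%:C * v%:C by rewrite rmorphM.
rewrite [in RHS]realM [in RHS]realM; set c1 := cis _; set c2 := cis _.
move: c1 c2 => c1 c2. ring.
Qed.


Lemma levels_mid m (x : m.-tuple (conf R n)) x0 i : (i < m)%N ->
  levels x i.+1 = angles (nth x0 x i).
Proof.
move=> im; rewrite /levels /= nth_rcons size_map size_tuple im.
by rewrite (nth_map x0) ?size_tuple.
Qed.

Lemma tnth_boundary (j : 'I_n) : tnth (boundary R n) j = j%:R.
Proof. by rewrite tnth_mktuple. Qed.

(** The boundary gives Delta(x^1) Delta(x^m) and a phase. [prod_det_steps] trades Delta(x^m) for a
    second Delta(x^1), giving the square in the Haar density, and supplies the opposite phase. *)
Lemma prod_det_levels m (x : m.+1.-tuple (conf R n)) :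
  ((Z_norm n m.+1 q)^-1)%:C *
    \prod_(r < m.+2) \det (\matrix_(j < n, k < n)
      phi n m.+1 q r (tnth (levels x r) j) (tnth (levels x r.+1) k)) =
  ((2 * pi) ^- n * Delta (thead x) ^+ 2 *
    path_density p (thead x) (behead x))%:C.
Proof.
case/tupleP: x => y s; rewrite theadE /=.
set x := [tuple of y :: s].
pose f r := \det (\matrix_(j < n, k < n)
  phi n m.+1 q r (tnth (levels x r) j) (tnth (levels x r.+1) k)).
have szs : size s = m by rewrite size_tuple.
have fmid i : (i < m)%N ->
    f i.+1 = \det (step_matrix (nth y (y :: s) i) (nth y (y :: s) i.+1)).
  move=> im; congr (\det _); apply/matrixP => j k; rewrite !mxE.
  rewrite /phi /= eqSS (ltn_eqF im).
  by rewrite !(levels_mid x y)// ltnW.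
have f0 : f 0%N = \det (\matrix_(j < n, k < n) cis (j%:R * tnth (angles y) k)).
  congr (\det _); apply/matrixP => j k; rewrite !mxE /phi /=.
  by rewrite (levels_mid x y)// [levels _ _]/= tnth_boundary.
have fm : f m.+1 =
    \det (\matrix_(j < n, k < n) cis (- (tnth (angles (last y s)) j * k%:R))).
  congr (\det _); apply/matrixP => j k; rewrite !mxE /phi /= eqxx.
  (* Level m + 1 is the last of the m + 1 states; level m + 2 lies just past them, at the
     boundary. *)
  rewrite (levels_mid x y)//= -[X in nth _ _ X]szs nth_last/=.
  rewrite /levels /= nth_rcons size_map szs ltnn eqxx.
  by rewrite tnth_boundary.
have -> : \prod_(r < m.+2) f r = f 0%N * f m.+1 * \prod_(i < m) f i.+1.
  by rewrite big_ord_recl big_ord_recr/= mulrAC mulrA.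
rewrite f0 fm det_boundary_levels.
rewrite (eq_bigr _ (fun (i : 'I_m) _ => fmid i (ltn_ord i))).
have := prod_det_steps y y s; rewrite szs.
set P := \prod_(i < m) _; set S := \sum_(j < n) _.
have realM (u v : R) : (u * v)%:C = u%:C * v%:C by rewrite rmorphM.
have -> : (Z_norm n m.+1 q)^-1 = tc ^- m * (1 - w) ^+ m * (2 * pi) ^- n.
  by rewrite /Z_norm /= !invfM invrK.
move=> PE.
transitivity (((1 - w) ^+ m * (2 * pi) ^- n * Delta y)%:C *
    cis (- (n'%:R / 2 * S)) * ((tc ^- m * Delta (last y s))%:C * P)).
  rewrite !realM; move: (cis _) => c; ring.
rewrite PE mulrA -[_ * _ * _%:C]mulrAC -!mulrA [_ * cis _]mulrC cisNK mulr1 -realM.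
have w0 : (1 - w) ^+ m != 0 by rewrite expf_neq0// monodromy_neq1.
move: (path_density _ _ _) ((2 * pi) ^- n) ((1 - w) ^+ m) w0 => pd c W W0.
by congr (_%:C); field.
Qed.

End product_of_determinants.

(** * The law of the stationary chain *)

Theorem theorem5p2 (R : realType) (n m : nat) (q : R)
  (n_gt0 : (0 < n)%N) (m_gt0 : (0 < m)%N) (q_gt0 : 0 < q) (q_neq1 : q != 1)
  (haar : probability (unitaryB R n) R) (haarP : is_haar haar)
  (mq : R.-pker (conf R n) ~> (conf R n))
  (mqP : forall (y : conf R n) (A : set (conf R n)), measurable A ->
    mq y A = m_q haar q y A)
  (mq_explicit : forall y : conf R n, Delta y != 0 ->
    forall A : set (conf R n), measurable A ->
    mq y A = (\int[conf_leb (n := n)]_(z in A) (m_q_density q y z)%:E)%E) :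
  has_complex_density
    (@chain_law _ _ R mq (conf_haar (n := n)) m)
    (power_measure (conf_leb (n := n)) m)
    (fun x : m.-tuple (conf R n) =>
      ((Z_norm n m q)^-1)%:C *
      \prod_(r < m.+1) \det (\matrix_(j < n, k < n)
        phi n m q r (tnth (levels x r) j) (tnth (levels x r.+1) k))).
Proof.
case: n m n_gt0 m_gt0 haar haarP mq mqP mq_explicit => [//|n] [//|m] _ _ _ _ mq _ mqE.
pose g (x : conf R n.+1) : R := (2 * pi) ^- n.+1 * Delta x ^+ 2.
pose p := @m_q_density R n.+1 q.
pose r (x : m.+1.-tuple (conf R n.+1)) : R :=
  g (thead x) * path_density p (thead x) (behead x).
have g0 x : 0 <= g x.
  by rewrite mulr_ge0 ?sqr_ge0// invr_ge0 exprn_ge0// mulr_ge0// pi_ge0.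
have mg : measurable_fun setT g.
  by apply: measurable_funM => //; apply: measurable_funX; exact: measurable_Delta.
have p0 y z : 0 <= p y z by exact: m_q_density_ge0.
have mp : measurable_fun setT (fun yz : conf R n.+1 * conf R n.+1 => p yz.1 yz.2).
  exact: measurable_m_q_density.
have r0 x : 0 <= r x by rewrite mulr_ge0 ?path_density_ge0.
have mr : measurable_fun setT r.
  apply: measurable_funM; first exact: (measurableT_comp mg (measurable_tnth ord0)).
  apply: (measurableT_comp (measurable_path_density mp (n := m))
    (g := fun t : m.+1.-tuple (conf R n.+1) => (thead t, [tuple of behead t]))).
  by apply: measurable_fun_pair; [exact: measurable_tnth|exact: measurable_behead].
have lawE A : measurable A -> @chain_law _ _ R mq (conf_haar (n := n.+1)) m.+1 A =
    (\int[power_measure (conf_leb (n := n.+1)) m.+1]_(x in A) (r x)%:E)%E.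
  (* Good states are those where the explicit kernel holds; at the others the factor [Delta] makes
     both [g] and [p y] vanish. *)
  apply: (chain_law_density (good := fun y => Delta y != 0) (p := p)) => //.
  - by move=> y z /negPn/eqP Dz; rewrite /p /m_q_density Dz mul0r mulr0 mul0r.
  - by move=> x /negPn/eqP Dx; rewrite /g Dx expr0n mulr0.
have gE x : ((Z_norm n.+1 m.+1 q)^-1)%:C * \prod_(r < m.+2)
    \det (\matrix_(j < n.+1, k < n.+1) phi n.+1 m.+1 q r
      (tnth (levels x r) j) (tnth (levels x r.+1) k)) = (r x)%:C.
  exact: prod_det_levels.
under eq_fun do rewrite gE.
split.
- rewrite /=; apply/integrableP; split; first exact/measurable_EFinP.
  (* As [r] is nonnegative, the integral of its absolute value is the total mass of the chain law,
     hence that of [conf_haar]. *)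
  under eq_integral do rewrite gee0_abs ?lee_fin//.
  rewrite -lawE// chain_law_setT; first exact: conf_haar_finite.
  by move=> y; exact: prob_kernel.
- exact: integrable0.
- by move=> A mA; split; [exact: lawE|exact: integral0].
Qed.
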